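(* Let $T$ be a linear operator generated by an endomorphism $\tau$ of $(\Omega,\beta,\mu)$, let $S_nf=\frac1n\sum_{i=0}^{n-1}T^if$, and let $f\in L_p(\Omega,X)$, $p>1$. If $(F_n)$ is a decreasing sequence of $\sigma$-subalgebras of $\beta$ with $F_n\downarrow F_\infty$ and $\sup_n\|S_nf\|_X\in L_1$, then for any $\varepsilon>0$ $$\mu\Big\{\sup_{n_1,n_2}\|E(S_{n_1}f|F_{n_2})\|_X\ge\varepsilon\Big\}\le\left(\frac p{p-1}\right)^p\frac{\|f\|_p^p}{\varepsilon^p}.$$
   Context: $X$ is a reflexive Banach space with norm $\|\cdot\|_X$, and $(\Omega,\beta,\mu)$ is a finite measure space. For $1\le p<\infty$, $L_p(\Omega,X)$ is the Banach space of (strongly) measurable functions $f:\Omega\to X$ with finite norm $\|f\|_p=\left(\int_\Omega\|f(\omega)\|_X^p\,d\mu\right)^{1/p}$; $L_p$ denotes this space for $X=\mathbb R$. For $f$ with values in $X$, $\|f\|_X$ denotes the function $\omega\mapsto\|f(\omega)\|_X$. $E(f|F)$ is the conditional expectation of $f$ with respect to a $\sigma$-subalgebra $F\subset\beta$. $F_n\downarrow F_\infty$ means that $(F_n)_{n\ge1}$ is decreasing and $F_\infty=\bigcap_nF_n$. A linear operator $T:L_1(\Omega,X)\to L_1(\Omega,X)$ is generated by an endomorphism $\tau$ (a measure-preserving transformation of $(\Omega,\beta,\mu)$) if $Tf=f\circ\tau$. *)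

(* Defs.v *)
From HB Require Import structures.
From mathcomp Require Import all_boot all_order all_algebra.
From mathcomp Require Import all_classical all_reals all_analysis.

Set Implicit Arguments.
Unset Strict Implicit.
Unset Printing Implicit Defensive.

Import Order.TTheory GRing.Theory Num.Theory.
Import numFieldNormedType.Exports.

Local Open Scope classical_set_scope.
Local Open Scope ring_scope.

(* Dual and bidual are kept as sets of maps rather than as bundled normed
   spaces: [dual X] is X', [bidual X] is X''. An element of [bidual X] is a map
   defined on all functions X -> R of which only the values on [dual X]
   matter. *)

Definition dual (R : realType) (X : normedModType R) : set (X -> R) :=
  [set phi | scalar phi /\ continuous (phi : X -> R^o)].

Definition dual_norm (R : realType) (X : normedModType R) (phi : X -> R) : R :=
  sup [set `|phi x| | x in [set x : X | `|x| <= 1]].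

Definition bidual (R : realType) (X : normedModType R) :
    set ((X -> R) -> R) :=
  [set Phi |
    (forall (a : R) (phi psi : X -> R), dual phi -> dual psi ->
       Phi (fun x => a * phi x + psi x) = a * Phi phi + Phi psi) /\
    (exists C : R, forall phi : X -> R, dual phi ->
       `|Phi phi| <= C * dual_norm phi)].

Definition reflexive_space (R : realType) (X : normedModType R) : Prop :=
  forall Phi, bidual (X := X) Phi ->
  exists x : X, forall phi, dual phi -> Phi phi = phi x.

Definition sub_sigma_algebra_of d (T : measurableType d) (F : set (set T)) :
    Prop :=
  sigma_algebra [set: T] F /\ F `<=` measurable.

Definition decreases_to (T : Type) (F : nat -> set (set T))
    (Finf : set (set T)) : Prop :=
  (forall m n, (m <= n)%N -> F n `<=` F m) /\ Finf = \bigcap_n F n.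

Definition simple_wrt (T : Type) (R : realType) (X : normedModType R)
    (F : set (set T)) (s : T -> X) : Prop :=
  finite_set (range s) /\ forall x, F (s @^-1` [set x]).

(* The approximation is required at every point, and not only almost
   everywhere: every class of functions modulo equality a.e. contains such a
   representative, and for it the sets defined through its norm belong to F
   even though the measure is not assumed to be complete. *)
Definition strongly_measurable (T : Type) (R : realType) (X : normedModType R)
    (F : set (set T)) (f : T -> X) : Prop :=
  exists s : nat -> T -> X, (forall n, simple_wrt F (s n)) /\
    forall w, s n w @[n --> \oo] --> f w.

Definition norm_Lp d (T : measurableType d) (R : realType)
    (X : normedModType R) (mu : {measure set T -> \bar R}) (p : R)
    (f : T -> X) : \bar R :=
  'N[mu]_p%:E[(fun w => `|f w|%:E)]%E.

Definition in_Lp d (T : measurableType d) (R : realType)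
    (X : normedModType R) (mu : {measure set T -> \bar R}) (p : R)
    (f : T -> X) : Prop :=
  strongly_measurable measurable f /\ (norm_Lp mu p f < +oo)%E.

Definition simple_integral d (T : measurableType d) (R : realType)
    (X : normedModType R) (mu : {measure set T -> \bar R}) (A : set T)
    (s : T -> X) : X :=
  \sum_(x \in range s) fine (mu (A `&` s @^-1` [set x])) *: x.

(* Over a finite measure every simple function is integrable, so nothing more
   is asked of the approximating sequence. *)
Definition is_bochner_integral d (T : measurableType d) (R : realType)
    (X : normedModType R) (mu : {finite_measure set T -> \bar R}) (A : set T)
    (f : T -> X) (v : X) : Prop :=
  exists s : nat -> T -> X,
  [/\ forall n, simple_wrt measurable (s n),
      (\int[mu]_(w in A) `|f w - s n w|%:E)%E @[n --> \oo] --> 0%E &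
      simple_integral mu A (s n) @[n --> \oo] --> v].

(* Meaningful for f in L_1; the default value 0 is used only for functions
   that are not Bochner integrable. *)
Definition bochner_integral d (T : measurableType d) (R : realType)
    (X : normedModType R) (mu : {finite_measure set T -> \bar R}) (A : set T)
    (f : T -> X) : X :=
  xget 0 [set v | is_bochner_integral mu A f v].

(* g is a version of E(f | F) *)
Definition is_cond_exp d (T : measurableType d) (R : realType)
    (X : normedModType R) (mu : {finite_measure set T -> \bar R})
    (F : set (set T)) (f g : T -> X) : Prop :=
  [/\ strongly_measurable F g, in_Lp mu 1 g &
      forall A, F A -> bochner_integral mu A g = bochner_integral mu A f].

Definition endomorphism d (T : measurableType d) (R : realType)
    (mu : {measure set T -> \bar R}) (tau : T -> T) : Prop :=
  measurable_fun [set: T] tau /\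
  forall A, measurable A -> mu (tau @^-1` A) = mu A.

Definition generated_by (T X : Type) (Top : (T -> X) -> (T -> X))
    (tau : T -> T) : Prop :=
  forall f, Top f = f \o tau.

Definition ergodic_average (T : Type) (R : realType) (X : normedModType R)
    (Top : (T -> X) -> (T -> X)) (n : nat) (f : T -> X) : T -> X :=
  fun w => n%:R^-1 *: \sum_(i < n) iter i Top f w.

(* Main.v *)
Require Import Defs.
From HB Require Import structures.
From mathcomp Require Import all_boot all_order all_algebra.
From mathcomp Require Import all_classical all_reals all_analysis.
From mathcomp Require Import measurable_realfun.
From mathcomp Require Import ring lra.
Set Implicit Arguments.
Unset Strict Implicit.
Unset Printing Implicit Defensive.

Import Order.TTheory GRing.Theory Num.Theory.
Import numFieldNormedType.Exports.
Local Open Scope classical_set_scope.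
Local Open Scope ring_scope.

(** Two maximal inequalities are composed, one for the averages along [tau]
    and one for the decreasing filtration. Put phi = |f|, let M_N be the
    largest of 0 and the first N ergodic averages of phi, and let
    J = (p / (p - 1))^p ||f||_p^p.

    Averages. Garsia's argument gives l mu{M_N >= l} <= int_{M_N >= l} phi for
    every l > 0 ([maximal_ergodic_inequality]), and any pair of nonnegative
    functions related in this way satisfies the L_p bound int M_N^p <= J
    ([weak_to_strong]).

    Filtration. For A in F_k and n <= N, conditional expectation is a
    contraction on A ([cond_exp_contraction]), and |S_n f| <= M_N pointwise, so
    int_A |E(S_n f|F_k)| <= int_A |S_n f| <= int_A M_N. Let W be the set where
    one of the finitely many |E(S_n f|F_k)| with n, k bounded in terms of N
    exceeds c. Scanning the indices with k decreasing, that is, along an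
    increasing filtration, and cutting W according to the first excess gives
    c mu(W) <= int_W M_N ([doob_reverse]), as in Doob's proof for martingales.
    Young's inequality turns this into c^p mu(W) <= int M_N^p <= J
    ([weak_to_markov]), with constant 1, so the factor (p / (p - 1))^p of the
    averages is the only one. Letting N grow and then c tend to eps ends the
    proof.

    The contraction property is where vector values matter. It comes from
    approximating the conditional expectation in L_1 by functions that are
    simple for F_k: on a level set B with value x, the norm of the integral of
    the constant x is the integral of its norm, and it is close to the norm of
    int_B E(S_n f|F_k) = int_B S_n f. *)

(** * Real powers *)

(** Young's inequality in the normalization in which the conjugate exponent
    appears only through [p - 1]: this is the one analytic input behind both
    [weak_to_strong] and [weak_to_markov]. *)
Lemma young_powR (R : realType) (p a b : R) : 1 < p -> 0 <= a -> 0 <= b ->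
  a * b `^ (p - 1) <= a `^ p / p + (1 - p^-1) * b `^ p.
Proof.
move=> p1 a0 b0.
have p0 : 0 < p by lra.
have pB0 : 0 < p - 1 by lra.
have -> : b `^ p = (b `^ (p - 1)) `^ (p / (p - 1)).
  by rewrite -powRrM mulrCA divff ?mulr1// gt_eqF.
have -> : 1 - p^-1 = (p / (p - 1))^-1 by field; rewrite !gt_eqF.
rewrite [_^-1 * _]mulrC; apply: conjugate_powR => //; first exact: powR_ge0.
  by rewrite divr_gt0.
by field; rewrite !gt_eqF.
Qed.

Lemma continuous_powR_gt0 (R : realType) (p x : R) : 0 < x ->
  y `^ p @[y --> x] --> x `^ p.
Proof.
move=> x0; have [/derivable1_diffP/differentiable_continuous cx _] :=
  is_derive1_powR p x0.
exact: cx.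
Qed.

(** * Garsia's inequality *)

Section maximal_ergodic.
Context d (T : measurableType d) (R : realType).
Variables (mu : {finite_measure set T -> \bar R}) (tau : T -> T).
Hypothesis tauP : endomorphism mu tau.

Lemma endomorphism_iter n : endomorphism mu (iter n tau).
Proof.
elim: n => [|n [mn mun]]; first by split => //=; exact: measurable_id.
split; first exact: (measurableT_comp tauP.1 mn).
move=> A mA; rewrite -(tauP.2 _ mA); apply: (mun (tau @^-1` A)).
by rewrite -[X in measurable X]setTI; exact: tauP.1.
Qed.

Lemma ge0_integral_endomorphism (h : T -> \bar R) :
  measurable_fun [set: T] h -> (forall w, 0 <= h w)%E ->
  (\int[mu]_w h (tau w) = \int[mu]_w h w)%E.
Proof.
move=> mh h0; have [mt mut] := tauP.
transitivity (\int[pushforward mu tau]_w h w)%E.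
  by rewrite ge0_integral_pushforward//=; move=> y _; exact: h0.
by apply: (eq_measure_integral mu) => A mA _; rewrite -mut.
Qed.

Lemma integrable_endomorphism (h : T -> R) :
  mu.-integrable [set: T] (EFin \o h) ->
  mu.-integrable [set: T] (EFin \o (h \o tau)).
Proof.
move=> /integrableP[mh ih]; apply/integrableP; split.
  exact: (measurableT_comp mh tauP.1).
rewrite /= (@ge0_integral_endomorphism (fun w => `|(h w)%:E|%E))//.
exact: measurableT_comp mh.
Qed.

(** The largest of the Birkhoff sums of [psi] of lengths 0, ..., n, written
    through S_(k+1) = psi + S_k \o tau so that the proof below can compare it
    with its own translate by [tau] (see [garsia_max]). *)
Fixpoint garsia (psi : T -> R) n : T -> R :=
  if n is n'.+1 then cst 0 \max (psi \+ (garsia psi n' \o tau)) else cst 0.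

Lemma garsia_ge0 psi n w : 0 <= garsia psi n w.
Proof. by case: n => [|n]//=; rewrite le_max lexx. Qed.

Lemma garsia_homo psi n w : garsia psi n w <= garsia psi n.+1 w.
Proof.
elim: n w => [|n IH] w; first exact: garsia_ge0.
by rewrite /= le_max2// lerD2l; exact: IH.
Qed.

Lemma integrable_garsia psi n : mu.-integrable [set: T] (EFin \o psi) ->
  mu.-integrable [set: T] (EFin \o garsia psi n).
Proof.
move=> ipsi; elim: n => [|n IH] /=; first exact: finite_measure_integrable_cst.
have iD : mu.-integrable [set: T] (EFin \o (psi \+ (garsia psi n \o tau))).
  exact: (integrableD measurableT ipsi (integrable_endomorphism IH)).
apply: (le_integrable measurableT _ _ iD) => //=.
  apply/measurable_EFinP; apply: measurable_maxr => //.
  by have /integrableP[/measurable_EFinP] := iD.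
by move=> w _; rewrite lee_fin [X in `|X|]/Order.max; case: ifP => //; rewrite normr0.
Qed.

(** Write P_n for [garsia psi n]. On the set E of the statement
    psi = P_(n+1) - P_n \o tau, while off E the function P_(n+1) vanishes and
    P_n \o tau is nonnegative. Hence int_E psi is at least
    int P_(n+1) - int P_n \o tau = int P_(n+1) - int P_n >= 0, by invariance
    of the measure. *)
Lemma garsia_integral psi n : mu.-integrable [set: T] (EFin \o psi) ->
  (0 <= \int[mu]_(w in [set w | (0 <= psi w + garsia psi n (tau w))%R])
         (psi w)%:E)%E.
Proof.
move=> ipsi; set E := [set w | _].
have iP := integrable_garsia n ipsi.
have iPS := integrable_garsia n.+1 ipsi.
have iPt := integrable_endomorphism iP.
have mE : measurable E.
  have : measurable_fun [set: T] (psi \+ (garsia psi n \o tau)).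
    apply: measurable_funD; apply/measurable_EFinP; [by case/integrableP: ipsi|].
    by case/integrableP: iPt.
  move=> /(_ measurableT `[0, +oo[%classic (measurable_itv _)); rewrite setTI.
  by congr measurable; apply/seteqP; split => w /=; rewrite in_itv/= andbT.
have sub h : mu.-integrable [set: T] h -> mu.-integrable E h.
  by apply: integrableS.
have -> : (\int[mu]_(w in E) (psi w)%:E =
    \int[mu]_(w in E) ((garsia psi n.+1 w)%:E - (garsia psi n (tau w))%:E))%E.
  apply: eq_integral => w /set_mem Ew; rewrite /= -EFinB.
  by rewrite (max_r Ew)/= addrK.
rewrite integralB_EFin//; [|exact: sub|exact: (sub (EFin \o (_ \o tau)))].
rewrite sube_ge0; last first.
  by apply/orP; left; apply: integrable_fin_num => //; exact: (sub (EFin \o (_ \o tau))).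
have mh h : mu.-integrable [set: T] h -> measurable_fun [set: T] h.
  by case/integrableP.
apply: (@le_trans _ _ (\int[mu]_w (garsia psi n (tau w))%:E)%E).
  apply: ge0_subset_integral => //; first exact: (mh (EFin \o (_ \o tau))).
  by move=> w _; rewrite lee_fin; exact: garsia_ge0.
rewrite (@ge0_integral_endomorphism (EFin \o garsia psi n)); last 2 first.
  - exact: mh.
  - by move=> w; rewrite lee_fin; exact: garsia_ge0.
apply: (@le_trans _ _ (\int[mu]_w (garsia psi n.+1 w)%:E)%E).
  apply: le_integral => //= w _; rewrite lee_fin; exact: garsia_homo.
rewrite [leRHS]integral_mkcond; apply: ge0_le_integral => //.
- by move=> w _; rewrite lee_fin; exact: garsia_ge0.
- exact: mh.
- by apply/measurable_restrict => //; rewrite setTI; apply: measurable_funTS; exact: mh.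
- move=> w _; rewrite patchE; case: ifPn => // /negP wE.
  rewrite lee_fin /= ge_max lexx/= leNgt; apply/negP => h; apply: wE.
  by apply/mem_set; exact: ltW.
Qed.

End maximal_ergodic.

(** * The maximal ergodic inequality *)

Section maximal_function.
Context d (T : measurableType d) (R : realType).
Variables (mu : {finite_measure set T -> \bar R}) (tau : T -> T).
Hypothesis tauP : endomorphism mu tau.

Let birkhoff (phi : T -> R) n (w : T) : R := \sum_(i < n) phi (iter i tau w).

Fixpoint ergodic_max (phi : T -> R) N : T -> R :=
  if N is n.+1 then
    ergodic_max phi n \max
      (fun w => N%:R^-1 * \sum_(i < N) phi (iter i tau w))
  else cst 0.

Lemma ergodic_max_ge0 phi N w : 0 <= ergodic_max phi N w.
Proof. by elim: N => //= N IH; rewrite le_max IH. Qed.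

Lemma le_ergodic_max (l : R) phi N w : 0 < l ->
  l <= ergodic_max phi N w <->
  exists2 n, (0 < n <= N)%N & l <= n%:R^-1 * \sum_(i < n) phi (iter i tau w).
Proof.
move=> l0; elim: N => [|N IH] /=.
  split; first by rewrite leNgt l0.
  by case=> -[|n] /andP[].
rewrite le_max; split.
  case/orP=> [/IH[n /andP[n0 nN] ln]|h].
    by exists n => //; rewrite n0 (leq_trans nN).
  by exists N.+1; rewrite ?leqnn.
case=> n /andP[n0]; rewrite leq_eqVlt => /predU1P[->->|nN ln].
  by rewrite orbT.
by apply/orP; left; apply/IH; exists n => //; rewrite n0.
Qed.

Lemma measurable_ergodic_max phi N : measurable_fun [set: T] phi ->
  measurable_fun [set: T] (ergodic_max phi N).
Proof.
move=> mphi; elim: N => [|N IH]; first exact: measurable_cst.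
apply: measurable_maxr => //; apply: measurable_funM => //.
apply: measurable_sum => i.
exact: (measurableT_comp mphi (endomorphism_iter tauP i).1).
Qed.

Lemma birkhoffS psi n w : birkhoff psi n.+1 w = psi w + birkhoff psi n (tau w).
Proof.
rewrite /birkhoff big_ord_recl; congr (_ + _); apply: eq_bigr => i _.
by rewrite -iterSr.
Qed.

Lemma garsia_max psi n w :
  (forall k, (k <= n)%N -> birkhoff psi k w <= garsia tau psi n w) /\
  exists2 k, (k <= n)%N & garsia tau psi n w = birkhoff psi k w.
Proof.
elim: n w => [|n IH] w.
  split; last by exists 0%N => //; rewrite /birkhoff big_ord0.
  by move=> k; rewrite leqn0 => /eqP->; rewrite /birkhoff big_ord0.
have [le_g [k0 k0n eg]] := IH (tau w); split.
  move=> [|k] kn; first by rewrite /birkhoff big_ord0; exact: garsia_ge0.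
  by rewrite birkhoffS /= le_max lerD2l le_g// orbT.
rewrite /=/Order.max/=; case: ifPn => _.
  by exists k0.+1 => //; rewrite birkhoffS eg.
by exists 0%N => //; rewrite /birkhoff big_ord0.
Qed.

(** An average of [phi] reaches [l] exactly when a nonempty Birkhoff sum of
    [phi - l] is nonnegative. This puts the level sets of the maximal function
    in the form of [garsia_integral]. *)
Lemma garsia_ergodic_max (l : R) phi N w : 0 < l ->
  l <= ergodic_max phi N.+1 w <->
  0 <= (phi w - l) + garsia tau (fun w => phi w - l) N (tau w).
Proof.
move=> l0; set psi := fun w => phi w - l.
have avgE n : (0 < n)%N ->
    (l <= n%:R^-1 * \sum_(i < n) phi (iter i tau w)) = (0 <= birkhoff psi n w).
  move=> n0; rewrite /birkhoff /psi sumrB sumr_const card_ord subr_ge0.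
  by rewrite mulrC ler_pdivlMr ?ltr0n// mulr_natr.
rewrite le_ergodic_max//; have [le_g [k0 k0N eg]] := garsia_max psi N (tau w).
split=> [[[//|n] /= nN]|h].
  rewrite avgE// birkhoffS => /le_trans; apply.
  by rewrite lerD2l le_g.
by exists k0.+1 => //; rewrite avgE// birkhoffS -eg.
Qed.

Lemma maximal_ergodic_inequality (l : R) phi N : 0 < l ->
  mu.-integrable [set: T] (EFin \o phi) ->
  (l%:E * mu [set w | (l <= ergodic_max phi N w)%R] <=
   \int[mu]_(w in [set w | (l <= ergodic_max phi N w)%R]) (phi w)%:E)%E.
Proof.
move=> l0 iphi; have mphi : measurable_fun [set: T] phi.
  by apply/measurable_EFinP; case/integrableP: iphi.
case: N => [|N].
  rewrite (_ : [set _ | _] = set0) ?measure0 ?mule0 ?integral_set0//.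
  by apply/seteqP; split => w //=; rewrite leNgt l0.
set E := [set w | _].
have mE : measurable E.
  have := measurable_ergodic_max N.+1 mphi.
  move=> /(_ measurableT `[l, +oo[%classic (measurable_itv _)); rewrite setTI.
  by congr measurable; apply/seteqP; split => w /=; rewrite in_itv/= andbT.
pose psi w := phi w - l.
have il A : measurable A -> mu.-integrable A (EFin \o cst l).
  by move=> mA; exact: finite_measure_integrable_cst.
have ipsi : mu.-integrable [set: T] (EFin \o psi).
  exact: (integrableB _ iphi (il _ measurableT)).
have := garsia_integral tauP N ipsi.
have -> : [set w | 0 <= psi w + garsia tau psi N (tau w)] = E.
  by apply/seteqP; split => w; move/(garsia_ergodic_max phi N w l0).
rewrite (_ : (fun w => (psi w)%:E) = (fun w => (phi w)%:E - (cst l w)%:E)%E)//.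
rewrite integralB_EFin//; [|exact: integrableS iphi|exact: il].
rewrite (_ : \int[mu]_(w in E) (cst l w)%:E = l%:E * mu E)%E.
  by rewrite sube_ge0// fin_numM// fin_num_measure.
exact: (integral_cst mu mE l%:E).
Qed.

End maximal_function.

(** * From the weak type inequality to the L_p bound *)

Section weak_to_strong.
Context d (T : measurableType d) (R : realType).
Variables (mu : {finite_measure set T -> \bar R}) (p : R) (M phi : T -> R).
Hypotheses (p1 : 1 < p).
Hypotheses (mM : measurable_fun [set: T] M) (mphi : measurable_fun [set: T] phi).
Hypotheses (M0 : forall w, 0 <= M w) (phi0 : forall w, 0 <= phi w).
Hypothesis weak : forall l : R, 0 < l ->
  (l%:E * mu [set w | (l <= M w)%R] <=
   \int[mu]_(w in [set w | (l <= M w)%R]) (phi w)%:E)%E.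

(** The usual proof integrates the hypothesis against l^(p-2) dl. Here [M] is
    rounded down to a multiple of [delta] and cut at [K * delta], which turns
    this integral into a finite Abel summation over level sets of [M]. The
    bound obtained is the same for every grid, and the cut makes the left-hand
    side finite, as the absorption at the end requires. *)
Section grid.
Variables (delta : R) (K : nat).
Hypothesis delta0 : 0 < delta.

Let m w := minn K (Num.trunc (M w / delta)).
Let L j := [set w | j.+1%:R * delta <= M w].

Let mL j : measurable (L j).
Proof.
have := mM measurableT (measurable_itv `[j.+1%:R * delta, +oo[).
by rewrite setTI; congr measurable; apply/seteqP; split => w /=;
  rewrite in_itv/= andbT.
Qed.

Let levelE (h : nat -> R) w :
  h (m w) = h 0%N + \sum_(j < K) (h j.+1 - h j) * \1_(L j) w.
Proof.
have indicE j : \1_(L j) w = (j < Num.trunc (M w / delta))%:R :> R.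
  rewrite indicE truncn_gt_nat ler_pdivlMr//; congr (_%:R); congr nat_of_bool.
  by apply/idP/idP => [/set_mem|/mem_set].
rewrite /m; set t := Num.trunc _ in indicE *.
elim: K => [|k IH]; first by rewrite min0n big_ord0 addr0.
rewrite big_ord_recr/= addrA -IH indicE; case: (boolP (k < t)%N) => [kt|]; last rewrite -leqNgt => kt.
  by rewrite (minn_idPl kt) (minn_idPl (ltnW kt)) mulr1 addrC subrK.
by rewrite mulr0 addr0 (minn_idPr kt) (minn_idPr (leqW kt)).
Qed.

Lemma measurable_level (h : nat -> R) : measurable_fun [set: T] (fun w => h (m w)).
Proof.
under eq_fun do rewrite levelE.
apply: measurable_funD => //; apply: measurable_sum => j.
by apply: measurable_funM => //; exact: measurable_indic.
Qed.

Let integral_level (u : T -> R) (h : nat -> R) : measurable_fun [set: T] u ->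
  (forall w, 0 <= u w) -> h 0%N = 0 -> (forall j, h j <= h j.+1) ->
  (\int[mu]_w (u w * h (m w))%:E =
   \sum_(j < K) (h j.+1 - h j)%:E * \int[mu]_(w in L j) (u w)%:E)%E.
Proof.
move=> mu_ u0 h0 hS.
have mg j : measurable_fun [set: T] (fun w => u w * \1_(L j) w).
  by apply: measurable_funM => //; exact: measurable_indic.
under eq_integral => w _.
  rewrite levelE h0 add0r mulr_sumr.
  under eq_bigr do rewrite mulrCA.
  rewrite -sumEFin; over.
rewrite ge0_integral_sum//=; last 2 first.
- move=> j; apply/measurable_EFinP.
  by apply: measurable_funM => //.
- by move=> j w _; rewrite lee_fin !mulr_ge0// subr_ge0.
apply: eq_bigr => j _.
under eq_integral do rewrite EFinM.
rewrite ge0_integralZl_EFin//; last 3 first.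
- by move=> w _; rewrite lee_fin mulr_ge0.
- exact/measurable_EFinP.
- by rewrite subr_ge0.
congr (_ * _)%E; rewrite [RHS]integral_mkcond; apply: eq_integral => w _.
rewrite patchE indicE; case: ifPn => /= _; first by rewrite mulr1.
by rewrite mulr0.
Qed.

(** With s the rounded function, v_j = j * delta and
    w_j = v_(j+1)^(p-1) - v_j^(p-1), Young's inequality gives
    (1 - 1/p) (v_(j+1)^p - v_j^p) <= w_j v_(j+1). Summing the weak type
    inequality at the levels v_(j+1) with weights w_j yields
    (1 - 1/p) int s^p <= int phi s^(p-1); Young's inequality for the right-hand
    side then lets a finite multiple of int s^p be absorbed. *)
Lemma weak_to_strong_grid :
  (\int[mu]_w (((m w)%:R * delta) `^ p)%:E <=
   \int[mu]_w ((p / (p - 1) * phi w) `^ p)%:E)%E.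
Proof.
have p0 : 0 < p := lt_trans ltr01 p1.
have pB0 : 0 < p - 1 by rewrite subr_gt0.
have q0 : 0 <= 1 - p^-1 by rewrite subr_ge0 invf_le1// ltW.
pose v (j : nat) : R := j%:R * delta.
have v0 j : 0 <= v j by rewrite mulr_ge0// ltW.
have vS j : v j <= v j.+1 by rewrite ler_pM2r// ler_nat.
pose w j := v j.+1 `^ (p - 1) - v j `^ (p - 1).
have w0 j : 0 <= w j by rewrite subr_ge0 ge0_ler_powR// ?nnegrE// ltW.
pose H k := \sum_(j < k) w j * v j.+1.
have HS j : H j.+1 - H j = w j * v j.+1.
  by rewrite /H big_ord_recr/= addrAC subrr add0r.
have vH k : (1 - p^-1) * v k `^ p <= H k.
  elim: k => [|k IH].
    by rewrite /H big_ord0 /v mul0r powR0 ?mulr0// gt_eqF.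
  rewrite /H big_ord_recr/= -/(H k).
  have := young_powR p1 (v0 k.+1) (v0 k).
  have -> : w k * v k.+1 = v k.+1 `^ p - v k.+1 * v k `^ (p - 1).
    by rewrite -(mulr_powRB1 (v0 _) p0) /w; ring.
  have -> : v k.+1 `^ p / p = p^-1 * v k.+1 `^ p by rewrite mulrC.
  by move: IH; rewrite !mulrBl !mul1r; lra.
have mv (r : R) : measurable_fun [set: T] (fun x => v (m x) `^ r).
  exact: (measurable_level (fun k => v k `^ r)).
have mvE (r : R) : measurable_fun [set: T] (fun x => (v (m x) `^ r)%:E).
  exact/measurable_EFinP.
have step1 : ((1 - p^-1)%:E * \int[mu]_x (v (m x) `^ p)%:E <=
    \int[mu]_x (phi x * v (m x) `^ (p - 1))%:E)%E.
  rewrite -ge0_integralZl_EFin//; last first.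
    by move=> x _; rewrite lee_fin powR_ge0.
  apply: (@le_trans _ _ (\int[mu]_x (1 * H (m x))%:E)%E).
    apply: ge0_le_integral => //.
    - by move=> x _; rewrite lee_fin mulr_ge0// powR_ge0.
    - exact: measurable_funeM.
    - apply/measurable_EFinP; apply: measurable_funM; first exact: measurable_cst.
      exact: (measurable_level H).
    - by move=> x _; rewrite mul1r -EFinM lee_fin.
  rewrite (@integral_level (cst 1) H)//; last 2 first.
  - by rewrite /H big_ord0.
  - by move=> j; rewrite -subr_ge0 HS mulr_ge0.
  rewrite (@integral_level phi (fun k => v k `^ (p - 1)))//; last 2 first.
  - by rewrite /v mul0r powR0// gt_eqF.
  - by move=> j; rewrite -subr_ge0; exact: w0.
  apply: lee_sum => j _; rewrite HS EFinM -muleA.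
  rewrite lee_wpmul2l ?lee_fin//.
  rewrite (_ : \int[mu]_(x in L j) _ = mu (L j))%E; last first.
    by rewrite (integral_cst mu (mL j) 1%E) mul1e.
  by apply: weak; rewrite mulr_gt0.
set q := p / (p - 1).
have q_gt0 : 0 < q by rewrite divr_gt0.
pose I := (\int[mu]_x (v (m x) `^ p)%:E)%E.
pose J := (\int[mu]_x ((q * phi x) `^ p)%:E)%E.
have mqphi : measurable_fun [set: T] (fun x => (q * phi x) `^ p).
  by apply: (measurableT_comp (measurable_powR p)); exact: measurable_funM.
have step2 : (I <= (p^-1)%:E * J + (1 - p^-1)%:E * I)%E.
  apply: (@le_trans _ _ (q%:E * \int[mu]_x (phi x * v (m x) `^ (p - 1))%:E)%E).
    have -> : I = (q%:E * ((1 - p^-1)%:E * I))%E.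
      rewrite muleA -EFinM (_ : q * _ = 1) ?mul1e// /q.
      by field; rewrite !gt_eqF.
    by rewrite lee_wpmul2l// lee_fin ltW.
  rewrite -ge0_integralZl_EFin//; last 3 first.
  - by move=> x _; rewrite lee_fin mulr_ge0// powR_ge0.
  - by apply/measurable_EFinP; exact: measurable_funM.
  - exact: ltW.
  rewrite -ge0_integralZl_EFin//; last 3 first.
  - by move=> x _; rewrite lee_fin powR_ge0.
  - exact/measurable_EFinP.
  - by rewrite invr_ge0 ltW.
  rewrite -ge0_integralZl_EFin//; last first.
    by move=> x _; rewrite lee_fin powR_ge0.
  rewrite -ge0_integralD//; last 4 first.
  - by move=> x _; rewrite -EFinM lee_fin mulr_ge0 ?powR_ge0 ?invr_ge0 ?ltW.
  - by apply: measurable_funeM; exact/measurable_EFinP.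
  - by move=> x _; rewrite -EFinM lee_fin mulr_ge0 ?powR_ge0.
  - exact: measurable_funeM.
  apply: ge0_le_integral => //.
  - by move=> x _; rewrite -EFinM lee_fin mulr_ge0 ?(ltW q_gt0)// mulr_ge0// powR_ge0.
  - by apply: measurable_funeM; apply/measurable_EFinP; exact: measurable_funM.
  - apply: emeasurable_funD; apply: measurable_funeM => //.
    exact/measurable_EFinP.
  - move=> x _; rewrite -!EFinM -EFinD lee_fin mulrA [p^-1 * _]mulrC.
    by apply: young_powR => //; rewrite mulr_ge0// ltW.
have Ifin : I \is a fin_num.
  rewrite ge0_fin_numE; last first.
    by apply: integral_ge0 => x _; rewrite lee_fin powR_ge0.
  apply: (@le_lt_trans _ _ (\int[mu]_x (cst (v K `^ p) x)%:E)%E).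
    apply: ge0_le_integral => //.
    - by move=> x _; rewrite lee_fin powR_ge0.
    - exact/measurable_EFinP.
    - move=> x _; rewrite lee_fin ge0_ler_powR ?nnegrE// ?(ltW p0)//.
      by rewrite ler_pM2r// ler_nat geq_minl.
  rewrite (integral_cst mu measurableT (v K `^ p)%:E).
  by rewrite ltey_eq fin_numM// fin_num_measure.
change (I <= J)%E; move: step2.
have : (0 <= J)%E by apply: integral_ge0 => x _; rewrite lee_fin powR_ge0.
rewrite -(fineK Ifin); case: J => [J| |]//= J0; last by rewrite leey.
rewrite -!EFinM -EFinD !lee_fin => h.
have : p^-1 * fine I <= p^-1 * J by move: h; rewrite mulrBl mul1r; lra.
by rewrite ler_pM2l// invr_gt0.
Qed.

End grid.

(** Fatou's lemma along grids of mesh 1/(n+1). *)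
Lemma weak_to_strong :
  (\int[mu]_w (M w `^ p)%:E <= \int[mu]_w ((p / (p - 1) * phi w) `^ p)%:E)%E.
Proof.
have p0 : 0 < p := lt_trans ltr01 p1.
pose delta n : R := n.+1%:R^-1.
have delta0 n : 0 < delta n by rewrite invr_gt0.
(* With (n + 1)^2 steps of length 1/(n + 1) the cut is at height n + 1, so it
   has no effect at w once n + 1 >= M w. *)
pose s n w := (minn (n.+1 ^ 2) (Num.trunc (M w / delta n)))%:R * delta n.
have s_cvg w : s n w @[n --> \oo] --> M w.
  have d0 : delta n @[n --> \oo] --> 0 by exact: cvg_harmonic.
  have dM : M w - delta n @[n --> \oo] --> M w.
    by rewrite -[X in _ --> X]subr0; apply: cvgB => //; exact: cvg_cst.
  apply: (squeeze_cvgr _ dM (@cvg_cst _ _ _ _ _)).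
  near=> n.
  have Mn : M w <= n.+1%:R.
    near: n; exists (Num.trunc (M w)) => // n /= h.
    by rewrite (le_trans (ltW (truncnS_gt (M w))))// ler_nat.
  have x0 : 0 <= M w / delta n by rewrite divr_ge0// ltW.
  have /andP[t1 t2] := truncn_itv x0.
  have tn : (Num.trunc (M w / delta n) <= n.+1 ^ 2)%N.
    rewrite -(ler_nat R) (le_trans t1)// /delta invrK natrX expr2.
    by rewrite ler_wpM2r.
  rewrite /s (minn_idPr tn) lerBlDr; set t := Num.trunc _ in t1 t2 *.
  have -> : t%:R * delta n + delta n = t.+1%:R * delta n.
    by rewrite -natr1 mulrDl mul1r.
  by rewrite -ler_pdivrMr// (ltW t2)/= -ler_pdivlMr.
have sp_cvg w : ((s n w `^ p)%:E @[n --> \oo] --> (M w `^ p)%:E)%E.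
  apply: cvg_EFin; first by apply: nearW.
  have [Mw0|Mw0] := eqVneq (M w) 0.
    rewrite Mw0 (_ : _ \o _ = cst (0 `^ p)); first exact: cvg_cst.
    by apply/funext => n /=; rewrite /s Mw0 mul0r truncn0 minn0 mul0r.
  have Mw : 0 < M w by rewrite lt_def Mw0 M0.
  exact: (cvg_comp _ _ (s_cvg w) (continuous_powR_gt0 Mw)).
have ms n : measurable_fun [set: T] (fun w => (s n w `^ p)%:E).
  apply/measurable_EFinP; exact: (measurable_level (n.+1 ^ 2) (delta0 n)
    (fun k => (k%:R * delta n) `^ p)).
have sp0 n w : [set: T] w -> (0 <= (s n w `^ p)%:E)%E.
  by rewrite lee_fin powR_ge0.
have := fatou mu measurableT ms sp0.
under eq_integral do rewrite (cvg_limn_einf_sup (sp_cvg _)).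
move=> /le_trans; apply; rewrite limn_einf_lim; apply: lime_le.
  exact: is_cvg_einfs.
apply: nearW => n; apply: (le_trans _ (weak_to_strong_grid (n.+1 ^ 2) (delta0 n))).
by apply: ereal_inf_lbound; exists n => /=.
Unshelve. all: by end_near.
Qed.

End weak_to_strong.

(** * Simple and strongly measurable functions *)

Lemma simple_wrt_subset (T : Type) (R : realType) (X : normedModType R)
    (F G : set (set T)) (s : T -> X) :
  F `<=` G -> simple_wrt F s -> simple_wrt G s.
Proof. by move=> FG [fs Fs]; split => // x; exact: FG. Qed.

Lemma strongly_measurable_subset (T : Type) (R : realType)
    (X : normedModType R) (F G : set (set T)) (f : T -> X) :
  F `<=` G -> strongly_measurable F f -> strongly_measurable G f.
Proof.
move=> FG [s [ss sf]]; exists s; split => // n.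
exact: simple_wrt_subset (ss n).
Qed.

Section simple_functions.
Context d (T : measurableType d) (R : realType) (X : normedModType R).
Implicit Types s t : T -> X.

Lemma measurable_simple_comp s (h : X -> R) : simple_wrt measurable s ->
  measurable_fun [set: T] (fun w => h (s w)).
Proof.
move=> [fs ms] _ B mB; rewrite setTI.
have -> : (fun w => h (s w)) @^-1` B =
    \bigcup_(x in range s `&` h @^-1` B) s @^-1` [set x].
  apply/seteqP; split => w /=; first by move=> Bw; exists (s w).
  by move=> [x [_ Bx]] /= ->.
apply: fin_bigcup_measurable => //.
by apply: sub_finite_set fs => x [].
Qed.

Lemma simple_map2 (op : X -> X -> X) s t :
  simple_wrt measurable s -> simple_wrt measurable t ->
  simple_wrt measurable (fun w => op (s w) (t w)).
Proof.
move=> [fs ms] [ft mt]; split.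
  apply: (@sub_finite_set _ _ ((fun z => op z.1 z.2) @` (range s `*` range t))).
    by move=> _ [w _ <-]; exists (s w, t w).
  by apply: finite_image; exact: finite_setX.
move=> x.
have -> : (fun w => op (s w) (t w)) @^-1` [set x] =
    \bigcup_(z in (range s `*` range t) `&` [set z | op z.1 z.2 = x])
      (s @^-1` [set z.1] `&` t @^-1` [set z.2]).
  apply/seteqP; split => w /=; first by move=> e; exists (s w, t w).
  by move=> [[y z] [_ /= <-]] [/= -> ->].
apply: fin_bigcup_measurable; last by move=> z _; exact: measurableI.
by apply: (@sub_finite_set _ _ (range s `*` range t)) => [z []//|]; exact: finite_setX.
Qed.

Lemma simple_cst (x : X) : simple_wrt measurable (fun _ : T => x).
Proof.
split; first by apply: (sub_finite_set _ (finite_set1 x)) => _ [_ _ <-].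
move=> y; have [<-|xy] := pselect (x = y).
  by rewrite (_ : _ @^-1` _ = setT)//; apply/seteqP; split.
by rewrite (_ : _ @^-1` _ = set0)//; apply/seteqP; split.
Qed.

Lemma simple_patch s (A : set T) : measurable A -> simple_wrt measurable s ->
  simple_wrt measurable (fun w => if w \in A then s w else 0).
Proof.
move=> mA [fs ms]; split.
  apply: (@sub_finite_set _ _ (0 |` range s)); last by rewrite finite_setU.
  by move=> _ [w _ <-]; case: ifP; [right; exists w|left].
move=> x; have -> : (fun w => if w \in A then s w else 0) @^-1` [set x] =
    (A `&` s @^-1` [set x]) `|` (~` A `&` (fun=> 0) @^-1` [set x]).
  apply/seteqP; split => w /=.
    by case: ifPn => [/set_mem|/negP wA ex]; [left|right; split => // /mem_set].
  move=> [[Aw <-]|[nAw <-]]; first by rewrite mem_set.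
  by rewrite memNset.
apply: measurableU; first exact: measurableI.
by apply: measurableI; [exact: measurableC|exact: (simple_cst 0).2].
Qed.

Lemma ge0_integral_simple_partition (mu : {measure set T -> \bar R}) s (A : set T)
    (h : T -> \bar R) : simple_wrt measurable s -> measurable A ->
  measurable_fun [set: T] h -> (forall w, 0 <= h w)%E ->
  (\int[mu]_(w in A) h w = \sum_(x <- finmap.enum_fset (fset_set (range s)))
     \int[mu]_(w in A `&` s @^-1` [set x]) h w)%E.
Proof.
move=> [fs ms] mA mh h0.
have AE : A = \big[setU/set0]_(x <- finmap.enum_fset (fset_set (range s)))
    (A `&` s @^-1` [set x]).
  rewrite -bigcup_seq; apply/seteqP; split => [w Aw|w [x _ []]//].
  by exists (s w) => //=; rewrite in_fset_set// mem_set//; exists w.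
rewrite {1}AE ge0_integral_bigsetU//.
- by move=> x; exact: measurableI.
- by move=> x y _ _ [w [[_ /= <-] [_ /= <-]]].
- exact: measurable_funTS.
Qed.

End simple_functions.

Section strongly_measurable.
Context d (T : measurableType d) (R : realType) (X : normedModType R).
Implicit Types f g : T -> X.

Lemma measurable_norm_strongly g : strongly_measurable measurable g ->
  measurable_fun [set: T] (fun w => `|g w|).
Proof.
move=> [s [ss sg]].
apply: (@measurable_fun_cvg _ _ _ _ (fun n w => `|s n w|)) => [n|w _].
  exact: (measurable_simple_comp Num.norm (ss n)).
by apply: cvg_norm; exact: sg.
Qed.

Lemma strongly_measurable_map2 (op : X -> X -> X) f g :
  continuous (fun z : X * X => op z.1 z.2) ->
  strongly_measurable measurable f -> strongly_measurable measurable g ->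
  strongly_measurable measurable (fun w => op (f w) (g w)).
Proof.
move=> cop [s [ss sf]] [t [st tg]].
exists (fun n w => op (s n w) (t n w)); split.
  by move=> n; exact: simple_map2.
move=> w; pose u n := (s n w, t n w); pose h z := op z.1 z.2.
have cu : u n @[n --> \oo] --> (f w, g w) by exact: cvg_pair (sf w) (tg w).
exact: (cvg_comp u h cu (cop (f w, g w))).
Qed.

Lemma simple_strongly_measurable s : simple_wrt measurable s ->
  strongly_measurable (R := R) (X := X) (@measurable _ T) s.
Proof. by move=> ss; exists (fun=> s); split => // w; exact: cvg_cst. Qed.

Lemma strongly_measurable_comp f (tau : T -> T) :
  measurable_fun [set: T] tau -> strongly_measurable measurable f ->
  strongly_measurable measurable (f \o tau).
Proof.
move=> mtau [s [ss sf]]; exists (fun n => s n \o tau); split; last first.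
  by move=> w; exact: sf.
move=> n; have [fs ms] := ss n; split.
  by apply: sub_finite_set fs => _ [w _ <-]; exists (tau w).
by move=> x; rewrite -[X in measurable X]setTI; exact: (mtau measurableT _ (ms x)).
Qed.

(** Replacing an approximant by 0 wherever its norm exceeds twice that of [g]
    never increases the distance to [g], since there
    |g| < |s_n| - |g| <= |g - s_n|; the truncated sequence thus still converges
    and is dominated. *)
Lemma dominated_simple_approximation g : strongly_measurable measurable g ->
  exists t : nat -> T -> X, [/\ forall n, simple_wrt measurable (t n),
    forall w, t n w @[n --> \oo] --> g w &
    forall n w, `|g w - t n w| <= 3 * `|g w|].
Proof.
move=> mg; have mng := measurable_norm_strongly mg.
have [s [ss sg]] := mg.
pose A n := [set w | `|s n w| <= 2 * `|g w|].
have mA n : measurable (A n).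
  have m1 : measurable_fun [set: T] (fun w => 2 * `|g w| - `|s n w|).
    apply: measurable_funB; first exact: measurable_funM.
    exact: (measurable_simple_comp Num.norm (ss n)).
  have := m1 measurableT _ (measurable_itv `[0, +oo[).
  rewrite setTI; congr measurable; apply/seteqP; split => w /=;
    by rewrite in_itv/= andbT subr_ge0.
exists (fun n w => if w \in A n then s n w else 0).
have le_s n w : `|g w - (if w \in A n then s n w else 0)| <= `|g w - s n w|.
  case: ifPn => // /negP nA; rewrite subr0.
  have {nA} : 2 * `|g w| < `|s n w|.
    by rewrite ltNge; apply/negP => h; apply: nA; apply/mem_set.
  have := lerB_dist (s n w) (g w); rewrite distrC; lra.
split.
- by move=> n; exact: simple_patch.
- move=> w; apply/cvgrPdist_le => e e0.
  move/cvgrPdist_le: (sg w) => /(_ e e0); apply: filterS => n.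
  exact: le_trans.
- move=> n w; case: ifPn => [/set_mem Aw|_].
    rewrite (le_trans (ler_normB _ _))//; move: Aw; rewrite /A/=; lra.
  by rewrite subr0 ler_peMl// ler1n.
Qed.

End strongly_measurable.

(** Results on measurable types apply to a sub-sigma-algebra through the type
    generated by it. *)
Lemma sub_sigma_algebra_exceedance d (T : measurableType d) (R : realType)
    (X : normedModType R) (F : set (set T)) (g : T -> X) (c : R) :
  sub_sigma_algebra_of F -> strongly_measurable F g ->
  F [set w | c < `|g w|].
Proof.
move=> [sF _] mg.
have FE : (@measurable _ (g_sigma_algebraType F)) = F by exact: sigma_algebra_id.
have : @measurable_fun _ _ (g_sigma_algebraType F) R setT (fun w => `|g w|).
  by apply: measurable_norm_strongly; rewrite FE.
move=> /(_ measurableT _ (measurable_itv `]c, +oo[)).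
rewrite setTI FE; congr (F _); apply/seteqP.
by split => w /=; rewrite in_itv/= andbT.
Qed.

(** * The Bochner integral and conditional expectation *)

Section bochner.
Context d (T : measurableType d) (R : realType) (X : completeNormedModType R).
Variable mu : {finite_measure set T -> \bar R}.
Implicit Types (f g s t : T -> X) (A : set T) (F : set (set T)).

Definition L1_dist f g A : \bar R := (\int[mu]_(w in A) `|f w - g w|%:E)%E.

Lemma measurable_dist f g :
  strongly_measurable measurable f -> strongly_measurable measurable g ->
  measurable_fun [set: T] (fun w => `|f w - g w|%:E).
Proof.
move=> mf mg; apply/measurable_EFinP; apply: (@measurable_norm_strongly _ _ _ X).
apply: (strongly_measurable_map2 (op := fun x y => x - y)) => //.
move=> z; apply: (@continuousB _ _ _ fst snd); [exact: cvg_fst|exact: cvg_snd].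
Qed.

Lemma L1_dist_triangle f s t A : measurable A ->
  strongly_measurable measurable f -> strongly_measurable measurable s ->
  strongly_measurable measurable t ->
  (L1_dist s t A <= L1_dist f s A + L1_dist f t A)%E.
Proof.
move=> mA mf ms mt; rewrite /L1_dist -ge0_integralD//; last 2 first.
- by apply: measurable_funTS; exact: measurable_dist.
- by apply: measurable_funTS; exact: measurable_dist.
apply: ge0_le_integral => //.
- by apply: measurable_funTS; exact: measurable_dist.
- by apply: emeasurable_funD; apply: measurable_funTS; exact: measurable_dist.
- by move=> w _; rewrite -EFinD lee_fin (distrC (f w) (s w)); exact: ler_distD.
Qed.

Lemma L1_dist_subset f g A : measurable A ->
  strongly_measurable measurable f -> strongly_measurable measurable g ->
  (L1_dist f g A <= L1_dist f g [set: T])%E.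
Proof.
by move=> mA mf mg; apply: ge0_subset_integral => //; exact: measurable_dist.
Qed.

(** Both sums are expanded over the common refinement of the two partitions
    into level sets, where the integrand is constant; this also covers the
    bound of one integral, by taking [t = 0]. *)
Lemma simple_integral_dist s t A : measurable A ->
  simple_wrt measurable s -> simple_wrt measurable t ->
  (`|simple_integral mu A s - simple_integral mu A t|%:E <= L1_dist s t A)%E.
Proof.
move=> mA ss st; have [fs ms] := ss; have [ft mt] := st.
rewrite /simple_integral !fsbig_finite//.
set S := finmap.enum_fset _; set S' := finmap.enum_fset _.
pose G x y := fine (mu (A `&` s @^-1` [set x] `&` t @^-1` [set y])).
have G0 x y : 0 <= G x y by rewrite fine_ge0.
have part (u : T -> X) B : simple_wrt measurable u -> measurable B ->
    fine (mu B) = \sum_(x <- finmap.enum_fset (fset_set (range u)))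
      fine (mu (B `&` u @^-1` [set x] : set T)) :> R.
  move=> su mB; apply: EFin_inj; rewrite fineK ?fin_num_measure//.
  have /(_ (cst 1%E)) := ge0_integral_simple_partition mu su mB.
  rewrite integral_cst// mul1e => ->//; rewrite -sumEFin; apply: eq_bigr => x _.
  have mBx : measurable (B `&` u @^-1` [set x]) by apply: measurableI => //; exact: su.2.
  by rewrite integral_cst// mul1e fineK ?fin_num_measure.
have sE : \sum_(x <- S) fine (mu (A `&` s @^-1` [set x])) *: x =
    \sum_(x <- S) \sum_(y <- S') G x y *: x.
  apply: eq_bigr => x _; rewrite -scaler_suml; congr (_ *: _).
  by apply: part => //; exact: measurableI.
have tE : \sum_(y <- S') fine (mu (A `&` t @^-1` [set y])) *: y =
    \sum_(x <- S) \sum_(y <- S') G x y *: y.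
  rewrite exchange_big/=; apply: eq_bigr => y _; rewrite -scaler_suml.
  congr (_ *: _); rewrite (part s)//; last exact: measurableI.
  by apply: eq_bigr => x _; rewrite /G setIAC.
rewrite sE tE -sumrB.
have mst : measurable_fun [set: T] (fun w => `|s w - t w|%:E).
  by apply: measurable_dist; exact: simple_strongly_measurable.
rewrite /L1_dist (ge0_integral_simple_partition _ ss)//.
apply: (@le_trans _ _ (\sum_(x <- S) \sum_(y <- S') G x y * `|x - y|)%:E).
  rewrite lee_fin (le_trans (ler_norm_sum _ _ _))//; apply: ler_sum => x _.
  rewrite -sumrB (le_trans (ler_norm_sum _ _ _))//; apply: ler_sum => y _.
  by rewrite -scalerBr normrZ ger0_norm.
rewrite -sumEFin; apply: lee_sum => x _.
have mAx : measurable (A `&` s @^-1` [set x]) by exact: measurableI.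
rewrite (ge0_integral_simple_partition _ st)// -sumEFin; apply: lee_sum => y _.
have mAxy : measurable (A `&` s @^-1` [set x] `&` t @^-1` [set y]).
  exact: measurableI.
rewrite (@eq_integral _ _ _ _ _ (cst `|x - y|%:E)); last first.
  by move=> w /set_mem[[_ /= ->] ->].
by rewrite integral_cst// EFinM /G fineK ?fin_num_measure// muleC.
Qed.

(** Keeping the approximants simple for [F] is what makes their level sets
    available as test sets in the definition of conditional expectation. *)
Lemma L1_simple_approximation F f : sub_sigma_algebra_of F ->
  strongly_measurable F f -> (\int[mu]_w `|f w|%:E < +oo)%E ->
  exists2 t : nat -> T -> X, forall n, simple_wrt F (t n) &
    L1_dist f (t n) [set: T] @[n --> \oo] --> 0%E.
Proof.
move=> [sF Fm] mf intf.
have FE : (@measurable _ (g_sigma_algebraType F)) = F by exact: sigma_algebra_id.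
have [t [st tf dt]] : exists t : nat -> T -> X, [/\ forall n, simple_wrt F (t n),
    forall w, t n w @[n --> \oo] --> f w &
    forall n w, `|f w - t n w| <= 3 * `|f w|].
  rewrite -FE; apply: (@dominated_simple_approximation _ (g_sigma_algebraType F)).
  by rewrite FE.
have smt n : simple_wrt measurable (t n) := simple_wrt_subset Fm (st n).
exists t => //.
have {}mf := strongly_measurable_subset Fm mf.
have md n : measurable_fun [set: T] (fun w => `|f w - t n w|%:E).
  by apply: measurable_dist => //; exact: simple_strongly_measurable.
have mnf : measurable_fun [set: T] (fun w => `|f w|).
  exact: measurable_norm_strongly.
have inf : mu.-integrable [set: T] (fun w => (3 * `|f w|)%:E).
  have inf1 : mu.-integrable [set: T] (fun w => `|f w|%:E).
    apply/integrableP; split; first exact/measurable_EFinP.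
    by under eq_integral do rewrite gee0_abs//.
  by have := integrableZl measurableT 3 inf1.
have [] := @dominated_convergence _ T R mu setT measurableT
   (fun n w => `|f w - t n w|%:E) (cst 0%E) _ md (@measurable_cst _ _ _ _ _ _) _ inf.
- apply: aeW => w _; apply: cvg_EFin; first exact: nearW.
  rewrite -[X in _ --> X](@normr0 _ X) -(subrr (f w)).
  by apply: cvg_norm; apply: cvgB; [exact: cvg_cst|exact: tf].
- by apply: aeW => w n _; rewrite gee0_abs// lee_fin.
- by move=> _ _; rewrite integral0.
Qed.

(** [simple_integral_dist] passes to the limit along the sequence that defines
    [v]. The bound holds for every value that the definition accepts, hence for
    the one chosen by [bochner_integral]. *)
Lemma bochner_integral_dist f s A v : measurable A ->
  strongly_measurable measurable f -> simple_wrt measurable s ->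
  is_bochner_integral mu A f v ->
  (`|v - simple_integral mu A s|%:E <= L1_dist f s A)%E.
Proof.
move=> mA mf ss [t [st tf tv]].
apply/lee_addgt0Pr => e e0.
have e20 : 0 < e / 2 by rewrite divr_gt0.
have /cvgrPdist_le /(_ _ e20) near_v := tv.
have /fine_cvgP[near_fin /cvgrPdist_le /(_ _ e20) near_f] := tf.
near \oo => n.
have finD : L1_dist f (t n) A \is a fin_num by near: n.
have dv : `|v - simple_integral mu A (t n)| <= e / 2 by near: n.
have df : (L1_dist f (t n) A <= (e / 2)%:E)%E.
  have : `|0 - fine (L1_dist f (t n) A)| <= e / 2 by near: n.
  rewrite sub0r normrN ger0_norm; last first.
    by apply: fine_ge0; apply: integral_ge0.
  by rewrite -lee_fin fineK.
apply: (@le_trans _ _ (`|v - simple_integral mu A (t n)|%:E +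
    `|simple_integral mu A (t n) - simple_integral mu A s|%:E)%E).
  by rewrite -EFinD lee_fin ler_distD.
rewrite [e]splitr EFinD addeA [leRHS]addeC leeD//.
apply: (le_trans (simple_integral_dist mA (st n) ss)).
apply: (le_trans (L1_dist_triangle mA mf (simple_strongly_measurable (st n))
  (simple_strongly_measurable ss))).
by rewrite [leRHS]addeC leeD2r.
Unshelve. all: by end_near.
Qed.

Lemma sub_sigma_algebra_measurable : sub_sigma_algebra_of (@measurable _ T).
Proof. by split => //; exact: sigma_algebra_measurable. Qed.

Lemma is_bochner_integral_bochner f A : measurable A ->
  strongly_measurable measurable f -> (\int[mu]_w `|f w|%:E < +oo)%E ->
  is_bochner_integral mu A f (bochner_integral mu A f).
Proof.
move=> mA mf intf.
suff [v fv] : exists v, is_bochner_integral mu A f v by exact: (xgetPex _ (ex_intro _ v fv)).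
have [t st tf] := L1_simple_approximation sub_sigma_algebra_measurable mf intf.
have {}tf : L1_dist f (t n) A @[n --> \oo] --> 0%E.
  apply: (squeeze_cvge _ (cvg_cst _) tf); apply: nearW => n; apply/andP; split.
    by apply: integral_ge0.
  by apply: L1_dist_subset => //; exact: simple_strongly_measurable.
suff : cvgn (fun n => simple_integral mu A (t n)).
  by move=> /cvg_ex[v tv]; exists v, t; split.
apply/cauchy_cvgP; apply: cauchy_exP => e e0.
have e20 : 0 < e / 2 by rewrite divr_gt0.
have /fine_cvgP[near_fin /cvgrPdist_lt /(_ _ e20) near_f] := tf.
have small : \forall n \near \oo, (L1_dist f (t n) A < (e / 2)%:E)%E.
  near=> n.
  have finD : L1_dist f (t n) A \is a fin_num by near: n.
  have : `|0 - fine (L1_dist f (t n) A)| < e / 2 by near: n.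
  rewrite sub0r normrN ger0_norm; last first.
    by apply: fine_ge0; apply: integral_ge0.
  by rewrite -lte_fin fineK.
have [N _ hN] := small.
exists (simple_integral mu A (t N)); exists N => // n /= Nn.
rewrite -ball_normE/= -lte_fin.
apply: (le_lt_trans (simple_integral_dist mA (st N) (st n))).
apply: (le_lt_trans (L1_dist_triangle mA mf (simple_strongly_measurable (st N))
  (simple_strongly_measurable (st n)))).
by rewrite [e]splitr EFinD lteD//; apply: hN => /=.
Unshelve. all: by end_near.
Qed.

Lemma norm_bochner_integral f A : measurable A ->
  strongly_measurable measurable f -> (\int[mu]_w `|f w|%:E < +oo)%E ->
  (`|bochner_integral mu A f|%:E <= \int[mu]_(w in A) `|f w|%:E)%E.
Proof.
move=> mA mf intf.
have := bochner_integral_dist mA mf (simple_cst _ _)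
  (is_bochner_integral_bochner mA mf intf).
rewrite /L1_dist => /(_ 0).
under eq_integral do rewrite subr0.
suff -> : simple_integral mu A (cst (0 : X)) = 0 by rewrite subr0.
by apply: fsbig1 => _ [w _ <-]; rewrite scaler0.
Qed.

Lemma simple_integral_constant t A x : (forall w, A w -> t w = x) ->
  finite_set (range t) -> simple_integral mu A t = fine (mu A) *: x.
Proof.
move=> tx ft.
have [A0|/set0P[w0 Aw0]] := eqVneq A set0.
  rewrite A0 measure0 /= scale0r; apply: fsbig1 => y _.
  by rewrite set0I measure0 /= scale0r.
rewrite /simple_integral (fsbigD1 x)//=; last by exists w0 => //; exact: tx.
rewrite fsbig1 ?addr0; last first.
  move=> y [_ /= yx]; rewrite (_ : _ `&` _ = set0) ?measure0 ?scale0r//.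
  by apply/seteqP; split => w //= -[Aw ty]; apply: yx; rewrite -ty tx.
by congr (fine (mu _) *: _); apply/setIidPl => w Aw /=; exact: tx.
Qed.


(** If t is simple for F and close to g in L_1, then on each of its level sets
    B inside A, which belong to F, int_B |t| = |int_B t| is within
    int_B |g - t| of |int_B g| = |int_B f| <= int_B |f|. Sum over the level
    sets, then let t tend to g. *)
Lemma cond_exp_contraction F f g A : sub_sigma_algebra_of F ->
  strongly_measurable measurable f -> (\int[mu]_w `|f w|%:E < +oo)%E ->
  strongly_measurable F g -> (\int[mu]_w `|g w|%:E < +oo)%E ->
  (forall B, F B -> bochner_integral mu B g = bochner_integral mu B f) ->
  F A -> (\int[mu]_(w in A) `|g w|%:E <= \int[mu]_(w in A) `|f w|%:E)%E.
Proof.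
move=> sF mf intf mg intg gf FA; have [salF Fm] := sF.
have [t st tg] := L1_simple_approximation sF mg intg.
have {}mg := strongly_measurable_subset Fm mg.
have smt n : simple_wrt measurable (t n) := simple_wrt_subset Fm (st n).
have mt n := simple_strongly_measurable (smt n).
have mA := Fm _ FA.
have m0 := simple_strongly_measurable (simple_cst T (0 : X)).
have FI B C : F B -> F C -> F (B `&` C).
  have <- : (@measurable _ (g_sigma_algebraType F)) = F by exact: sigma_algebra_id.
  exact: measurableI.
have L0 (h : T -> X) B : L1_dist h (cst 0) B = (\int[mu]_(w in B) `|h w|%:E)%E.
  by rewrite /L1_dist; under eq_integral do rewrite subr0.
have mn (h : T -> X) : strongly_measurable measurable h ->
    measurable_fun [set: T] (fun w => `|h w|%:E).
  by move=> mh; apply/measurable_EFinP; exact: (@measurable_norm_strongly _ _ _ X).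
have key n : (\int[mu]_(w in A) `|t n w|%:E <=
    \int[mu]_(w in A) `|f w|%:E + L1_dist g (t n) A)%E.
  have part h mh h0 := @ge0_integral_simple_partition _ _ _ _ mu _ _ h (smt n) mA mh h0.
  rewrite /L1_dist (part _ (mn _ (mt n)))// (part _ (mn _ mf))//.
  rewrite (part _ (measurable_dist mg (mt n)))//.
  rewrite -big_split/=; apply: lee_sum => x _.
  set B := A `&` _.
  have FB : F B by apply: FI => //; exact: (st n).2.
  have mB := Fm _ FB.
  have tB w : B w -> t n w = x by case.
  have -> : (\int[mu]_(w in B) `|t n w|%:E =
      `|simple_integral mu B (t n)|%:E)%E.
    rewrite (simple_integral_constant tB (smt n).1) normrZ ger0_norm ?fine_ge0//.
    rewrite (@eq_integral _ _ _ _ _ (cst `|x|%:E)); last first.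
      by move=> w /set_mem /tB ->.
    by rewrite integral_cst// EFinM fineK ?fin_num_measure// muleC.
  apply: (@le_trans _ _ (`|bochner_integral mu B f|%:E +
      `|bochner_integral mu B g - simple_integral mu B (t n)|%:E)%E).
    rewrite -EFinD lee_fin -gf//.
    set a := bochner_integral _ _ _; set b := simple_integral _ _ _.
    by rewrite (distrC a) -{1}[b](subrK a) addrC ler_normD.
  apply: leeD; first exact: norm_bochner_integral.
  by apply: bochner_integral_dist => //; exact: is_bochner_integral_bochner.
apply/lee_addgt0Pr => e e0.
have e20 : 0 < e / 2 by rewrite divr_gt0.
have /fine_cvgP[near_fin /cvgrPdist_le /(_ _ e20) near_f] := tg.
near \oo => n.
have finD : L1_dist g (t n) [set: T] \is a fin_num by near: n.
have dg : (L1_dist g (t n) A <= (e / 2)%:E)%E.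
  apply: (le_trans (L1_dist_subset mA mg (mt n))).
  have : `|0 - fine (L1_dist g (t n) [set: T])| <= e / 2 by near: n.
  rewrite sub0r normrN ger0_norm; last first.
    by apply: fine_ge0; apply: integral_ge0.
  by rewrite -lee_fin fineK.
rewrite -L0; apply: (le_trans (L1_dist_triangle mA (mt n) mg m0)).
apply: (@le_trans _ _
    ((e / 2)%:E + (\int[mu]_(w in A) `|f w|%:E + (e / 2)%:E))%E); last first.
  by rewrite addeCA -EFinD -splitr.
apply: leeD; last by rewrite L0 (le_trans (key n))// leeD2l.
rewrite (_ : L1_dist (t n) g A = L1_dist g (t n) A)//.
by rewrite /L1_dist; apply: eq_integral => w _; rewrite distrC.
Unshelve. all: by end_near.
Qed.

End bochner.

(** * The maximal inequality for a filtration *)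

Section doob.
Context d (T : measurableType d) (R : realType).
Variable mu : {finite_measure set T -> \bar R}.

(** The part of [U n] outside the earlier sets still belongs to [F n], because
    the filtration increases; so the hypothesis applies to each piece of a
    disjoint decomposition of the union. *)
Lemma doob_filtration (F : nat -> set (set T)) (U : nat -> set T) (h : T -> \bar R)
    (c : R) n :
  (forall j, sub_sigma_algebra_of (F j)) -> (forall j, F j `<=` F j.+1) ->
  (forall j, F j (U j)) -> 0 <= c ->
  measurable_fun [set: T] h -> (forall w, 0 <= h w)%E ->
  (forall j A, F j A -> A `<=` U j -> c%:E * mu A <= \int[mu]_(w in A) h w)%E ->
  let V := \big[setU/set0]_(j < n) U j in
  (c%:E * mu V <= \int[mu]_(w in V) h w)%E.
Proof.
move=> sF FS FU c0 mh h0 cU /=.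
pose V n := \big[setU/set0]_(j < n) U j.
have FV m : F m (V m).
  elim: m => [|m IH]; first by rewrite /V big_ord0; case: (sF 0%N) => -[].
  rewrite /V big_ord_recr/=; apply: FS.
  have <- : (@measurable _ (g_sigma_algebraType (F m))) = F m.
    by apply: sigma_algebra_id; case: (sF m).
  apply: measurableU; rewrite /measurable/= sigma_algebra_id//;
    by [case: (sF m)|exact: IH].
rewrite -/(V n); elim: n => [|n IH].
  by rewrite /V big_ord0 measure0 mule0 integral_set0.
have FD : F n (U n `\` V n).
  have <- : (@measurable _ (g_sigma_algebraType (F n))) = F n.
    by apply: sigma_algebra_id; case: (sF n).
  apply: measurableD; rewrite /measurable/= sigma_algebra_id//;
    by [case: (sF n)|exact: FV].
have mV : measurable (V n) by exact: (sF n).2.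
have mD : measurable (U n `\` V n) by exact: (sF n).2.
have -> : V n.+1 = V n `|` (U n `\` V n).
  rewrite /V big_ord_recr/= -/(V n); apply/seteqP; split => w.
    by move=> [Vw|Uw]; [left|have [Vw|Vw] := pselect (V n w); [left|right]].
  by move=> [Vw|[Uw _]]; [left|right].
have VD : [disjoint V n & U n `\` V n] by rewrite disj_set2E setDIK.
rewrite ge0_integral_setU//; last exact: measurable_funTS.
rewrite measureU//; last exact: setDIK.
rewrite ge0_muleDr//; apply: leeD => //.
by apply: cU; [exact: FD|move=> w []].
Qed.

(** The pairs (n, k) with n, k <= N are listed with k decreasing from N to 0,
    all n being exhausted before k changes; along this list the decreasing
    family is an increasing filtration. Including all n at the same k costs
    nothing because only the sigma-algebra of index k is involved. *)
Lemma doob_reverse (F : nat -> set (set T)) (U : nat -> nat -> set T)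
    (h : T -> \bar R) (c : R) N :
  (forall k, sub_sigma_algebra_of (F k)) ->
  (forall m n, (m <= n)%N -> F n `<=` F m) ->
  (forall n k, F k (U n k)) -> 0 <= c ->
  measurable_fun [set: T] h -> (forall w, 0 <= h w)%E ->
  (forall n k A, (n <= N)%N -> F k A -> A `<=` U n k ->
    c%:E * mu A <= \int[mu]_(w in A) h w)%E ->
  let W := \bigcup_(n in `I_N.+1) \bigcup_(k in `I_N.+1) U n k in
  (c%:E * mu W <= \int[mu]_(w in W) h w)%E.
Proof.
move=> sF Fhomo FU c0 mh h0 cU /=; set W := \bigcup_(n in _) _.
pose V j := U (j %% N.+1)%N (N - j %/ N.+1)%N.
have -> : W = \big[setU/set0]_(j < N.+1 * N.+1) V j.
  rewrite -(bigcup_mkord _ V); apply/seteqP; split => w.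
    move=> [n /= nN [k /= kN Uw]].
    have jE : (((N - k) * N.+1 + n) %% N.+1 = n)%N by rewrite modnMDl modn_small.
    have jD : (((N - k) * N.+1 + n) %/ N.+1 = N - k)%N.
      by rewrite divnMDl// divn_small// addn0.
    exists ((N - k) * N.+1 + n)%N; last by rewrite /V jE jD subKn.
    by rewrite /= -ltn_divLR// jD ltnS leq_subr.
  move=> [j _ Vw]; exists (j %% N.+1)%N; first by rewrite /= ltn_mod.
  by exists (N - j %/ N.+1)%N => //; rewrite /= ltnS leq_subr.
apply: (doob_filtration (F := fun j => F (N - j %/ N.+1)%N) (U := V)) => //.
- by move=> j; apply: Fhomo; rewrite leq_sub2l// leq_div2r.
- by move=> j; exact: FU.
- by move=> j A; apply: cU; rewrite -ltnS ltn_mod.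
Qed.

(** Young's inequality bounds c^(p-1) h by h^p / p + (1 - 1/p) c^p on [V]; the
    last term is absorbed by the left-hand side, [mu V] being finite. *)
Lemma weak_to_markov (p c : R) (h : T -> R) (V : set T) : 1 < p -> 0 < c ->
  measurable V -> measurable_fun [set: T] h -> (forall w, 0 <= h w) ->
  (c%:E * mu V <= \int[mu]_(w in V) (h w)%:E)%E ->
  ((c `^ p)%:E * mu V <= \int[mu]_w (h w `^ p)%:E)%E.
Proof.
move=> p1 c0 mV mh h0 ch.
have p0 : 0 < p := lt_trans ltr01 p1.
have pi0 : 0 <= p^-1 by rewrite invr_ge0 ltW.
have q0 : 0 <= 1 - p^-1 by rewrite subr_ge0 invf_le1// ltW.
have mhp : measurable_fun [set: T] (fun w => (h w `^ p)%:E).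
  by apply/measurable_EFinP; exact: (measurableT_comp (measurable_powR p)).
set J := (\int[mu]_w (h w `^ p)%:E)%E.
have J0 : (0 <= J)%E by apply: integral_ge0 => w _; rewrite lee_fin powR_ge0.
have young : ((c `^ p)%:E * mu V <=
    (p^-1)%:E * J + ((1 - p^-1) * c `^ p)%:E * mu V)%E.
  have -> : c `^ p = c `^ (p - 1) * c by rewrite mulrC mulr_powRB1// ltW.
  rewrite EFinM -muleA.
  apply: (@le_trans _ _ ((c `^ (p - 1))%:E * \int[mu]_(w in V) (h w)%:E)%E).
    by rewrite lee_wpmul2l// lee_fin powR_ge0.
  rewrite -ge0_integralZl_EFin ?powR_ge0//; last 2 first.
  - by move=> w _; rewrite lee_fin.
  - by apply: measurable_funTS; exact/measurable_EFinP.
  apply: (@le_trans _ _ (\int[mu]_(w in V) ((p^-1)%:E * (h w `^ p)%:E +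
      cst ((1 - p^-1) * (c `^ (p - 1) * c))%:E w))%E).
    apply: ge0_le_integral => //.
    - by move=> w _; rewrite -EFinM lee_fin mulr_ge0// powR_ge0.
    - apply: measurable_funTS; apply: measurable_funeM; exact/measurable_EFinP.
    - apply: measurable_funTS; apply: emeasurable_funD => //.
      exact: measurable_funeM.
    - move=> w _; rewrite -!EFinM -EFinD lee_fin.
      have := young_powR p1 (h0 w) (ltW c0).
      by rewrite [_ / p]mulrC [h w * _]mulrC -(mulr_powRB1 (ltW c0) p0) [c * _]mulrC.
  rewrite ge0_integralD//; last 3 first.
  - by move=> w _; rewrite -EFinM lee_fin mulr_ge0// powR_ge0.
  - by apply: measurable_funTS; exact: measurable_funeM.
  - by move=> w _; rewrite lee_fin !mulr_ge0 ?powR_ge0// ltW.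
  rewrite integral_cst//; apply: leeD => //.
  rewrite ge0_integralZl_EFin//; last 2 first.
  - by move=> w _; rewrite lee_fin powR_ge0.
  - exact: measurable_funTS.
  rewrite lee_wpmul2l ?lee_fin//; apply: ge0_subset_integral => //.
  by move=> w _; rewrite lee_fin powR_ge0.
move: young J0; rewrite -(@fineK _ (mu V)) ?fin_num_measure//.
case: J => [J| |]//= => [|_ _]; last by rewrite leey.
rewrite -!EFinM -EFinD !lee_fin => h1 _.
have : p^-1 * (c `^ p * fine (mu V)) <= p^-1 * J.
  by move: h1; rewrite !mulrBl !mul1r; lra.
by rewrite ler_pM2l// invr_gt0.
Qed.

Lemma integrable_of_powR (p : R) (h : T -> R) : 1 < p ->
  measurable_fun [set: T] h -> (forall w, 0 <= h w) ->
  (\int[mu]_w (h w `^ p)%:E < +oo)%E -> mu.-integrable [set: T] (EFin \o h).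
Proof.
move=> p1 mh h0 hp.
have mhp : measurable_fun [set: T] (fun w => (h w `^ p)%:E).
  by apply/measurable_EFinP; exact: (measurableT_comp (measurable_powR p)).
have ihp : mu.-integrable [set: T] (fun w => (h w `^ p)%:E).
  apply/integrableP; split => //.
  by under eq_integral do rewrite gee0_abs ?lee_fin ?powR_ge0//.
have i1 := finite_measure_integrable_cst mu 1 measurableT.
apply: (le_integrable measurableT _ _ (integrableD measurableT i1 ihp)).
  exact/measurable_EFinP.
move=> w _ /=; rewrite lee_fin ger0_norm// ger0_norm ?addr_ge0 ?powR_ge0//.
have [h1|h1] := lerP (h w) 1; first by rewrite (le_trans h1)// lerDl powR_ge0.
apply: (@le_trans _ _ (h w `^ p)); last by rewrite lerDr.
by rewrite -{1}(powRr1 (h0 w)) ler_powR// ltW.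
Qed.

End doob.

(** * Ergodic averages *)

Section averages.
Context d (T : measurableType d) (R : realType) (X : normedModType R).
Variables (mu : {finite_measure set T -> \bar R}) (tau : T -> T).
Variables (Top : (T -> X) -> (T -> X)) (f : T -> X).
Hypotheses (tauP : endomorphism mu tau) (TopP : generated_by Top tau).

Lemma generated_by_iter i w : iter i Top f w = f (iter i tau w).
Proof. by elim: i w => //= i IH w; rewrite TopP /= IH -iterSr. Qed.

Lemma norm_ergodic_average_le n N w : (0 < n <= N)%N ->
  `|ergodic_average Top n f w| <= ergodic_max tau (fun v => `|f v|) N w.
Proof.
move=> nN; set a := `|_|; have [a0|] := ltrP 0 a; last first.
  by move=> /le_trans; apply; exact: ergodic_max_ge0.
apply/(le_ergodic_max _ _ _ _ a0); exists n => //.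
rewrite /a /ergodic_average normrZ ger0_norm ?invr_ge0// ler_wpM2l ?invr_ge0//.
rewrite (le_trans (ler_norm_sum _ _ _))//; apply: ler_sum => i _.
by rewrite generated_by_iter.
Qed.

Lemma strongly_measurable_ergodic_average n :
  strongly_measurable measurable f ->
  strongly_measurable measurable (ergodic_average Top n f).
Proof.
move=> mf; rewrite /ergodic_average.
apply: (strongly_measurable_map2 (op := fun x _ => n%:R^-1 *: x)
  (g := fun=> 0)) => //; first 1 last.
- elim: n => [|n IH].
    under eq_fun do rewrite big_ord0.
    exact/simple_strongly_measurable/simple_cst.
  under eq_fun do rewrite big_ord_recr/= generated_by_iter.
  apply: (strongly_measurable_map2 (op := fun x y => x + y)) => //.
    exact: add_continuous.
  apply: (strongly_measurable_comp _ mf); exact: (endomorphism_iter tauP n).1.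
- exact/simple_strongly_measurable/simple_cst.
- move=> z; exact: (cvg_comp fst (fun x : X => n%:R^-1 *: x) cvg_fst (@scaler_continuous _ _ n%:R^-1 z.1)).
Qed.

End averages.

(** * The maximal inequality for conditioned averages *)

Theorem theorem2p5 (R : realType) (X : completeNormedModType R)
    (hX : reflexive_space X)
    (d : measure_display) (Omega : measurableType d)
    (mu : {finite_measure set Omega -> \bar R})
    (tau : Omega -> Omega) (htau : endomorphism mu tau)
    (Top : (Omega -> X) -> (Omega -> X)) (hTop : generated_by Top tau)
    (p : R) (hp : 1 < p)
    (f : Omega -> X) (hf : in_Lp mu p f)
    (F : nat -> set (set Omega)) (Finf : set (set Omega))
    (hF : forall n, sub_sigma_algebra_of (F n))
    (hFinf : decreases_to F Finf)
    (hsup : mu.-integrable [set: Omega]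
       (fun w => ereal_sup [set `|ergodic_average Top n f w|%:E
                            | n in [set n | (0 < n)%N]]))
    (g : nat -> nat -> Omega -> X)
    (hg : forall n1 n2, (0 < n1)%N ->
       is_cond_exp mu (F n2) (ergodic_average Top n1 f) (g n1 n2))
    (eps : R) (heps : 0 < eps) :
  (mu [set w | eps%:E <= ereal_sup [set `|g n1 n2 w|%:E
                 | n1 in [set n | (0 < n)%N] & n2 in [set: nat]]]
   <= ((p / (p - 1)) `^ p)%:E * (norm_Lp mu p f `^ p * ((eps `^ p)^-1)%:E))%E.
Proof.
have p0 : 0 < p := lt_trans ltr01 hp.
have [mf nf] := hf.
pose phi w := `|f w|.
have mphi : measurable_fun [set: Omega] phi by exact: measurable_norm_strongly.
have phi0 w : 0 <= phi w by exact: normr_ge0.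
have normE : (norm_Lp mu p f `^ p = \int[mu]_w (phi w `^ p)%:E)%E.
  rewrite /norm_Lp poweR_Lnorm; last by rewrite gt_eqF.
  apply: eq_integral => w _.
  by rewrite abse_EFin normr_id.
have iphip : (\int[mu]_w (phi w `^ p)%:E < +oo)%E.
  by rewrite -normE poweR_lty.
pose J := (\int[mu]_w ((p / (p - 1) * phi w) `^ p)%:E)%E.
have JE : J = (((p / (p - 1)) `^ p)%:E * (norm_Lp mu p f `^ p))%E.
  rewrite normE -ge0_integralZl_EFin ?powR_ge0//; last 2 first.
  - by move=> w _; rewrite lee_fin powR_ge0.
  - by apply/measurable_EFinP; exact: (measurableT_comp (measurable_powR p)).
  apply: eq_integral => w _; rewrite powRM// divr_ge0// ltW//.
  by rewrite subr_gt0.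
have Jfin : (J < +oo)%E by rewrite JE normE lte_mul_pinfty// lee_fin powR_ge0.
have iphi := integrable_of_powR hp mphi phi0 iphip.
pose M N := ergodic_max tau phi N.
have mM N : measurable_fun [set: Omega] (M N).
  exact: (measurable_ergodic_max htau).
have M0 N w : 0 <= M N w by exact: ergodic_max_ge0.
have MJ N : (\int[mu]_w (M N w `^ p)%:E <= J)%E.
  apply: weak_to_strong => // l l0; exact: maximal_ergodic_inequality.
have iM N : mu.-integrable [set: Omega] (EFin \o M N).
  exact: (integrable_of_powR hp (mM N) (M0 N) (le_lt_trans (MJ N) Jfin)).
(* The domination that links the two maximal inequalities. *)
have gM n k N A : (0 < n <= N)%N -> F k A ->
    (\int[mu]_(w in A) `|g n k w|%:E <= \int[mu]_(w in A) (M N w)%:E)%E.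
  move=> nN FA; have n0 : (0 < n)%N by case/andP: nN.
  have mA := (hF k).2 _ FA.
  have [smg [_ ig] gE] := hg n k n0.
  have smS := strongly_measurable_ergodic_average htau hTop n mf.
  have leM w : `|ergodic_average Top n f w| <= M N w.
    exact: norm_ergodic_average_le.
  have mS := measurable_norm_strongly smS.
  have leI B : measurable B -> (\int[mu]_(w in B) `|ergodic_average Top n f w|%:E
      <= \int[mu]_(w in B) (M N w)%:E)%E.
    move=> mB; apply: ge0_le_integral => //.
    - by apply: measurable_funTS; exact/measurable_EFinP.
    - by apply: measurable_funTS; exact/measurable_EFinP.
    - by move=> w _; rewrite lee_fin.
  apply: le_trans (leI _ mA).
  apply: (cond_exp_contraction (hF k)) => //.
    apply: (le_lt_trans (leI _ measurableT)).
    have /integrableP[_] := iM N.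
    by under eq_integral do rewrite gee0_abs ?lee_fin//.
  move: ig; rewrite /norm_Lp Lnorm1.
  by under eq_integral do rewrite abse_EFin normr_id.
pose U c n k := [set w | c < `|g n k w|].
have FU c n k : (0 < n)%N -> F k (U c n k).
  by move=> n0; have [smg _ _] := hg n k n0; exact: sub_sigma_algebra_exceedance.
have mU c n k : (0 < n)%N -> measurable (U c n k).
  by move=> n0; apply: (hF k).2; exact: FU.
have Fhomo m n : (m <= n)%N -> F n `<=` F m by exact: hFinf.1.
pose W c N := \bigcup_(n in `I_N.+1) \bigcup_(k in `I_N.+1) U c n.+1 k.
have mW c N : measurable (W c N).
  by apply: bigcup_measurable => n _; apply: bigcup_measurable => k _; exact: mU.
have WJ c N : 0 < c -> ((c `^ p)%:E * mu (W c N) <= J)%E.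
  move=> c0; apply: le_trans (MJ N.+1); apply: weak_to_markov => //.
  apply: (doob_reverse (F := F) (U := fun n k => U c n.+1 k)) => //.
  - by move=> n k; exact: FU.
  - exact: ltW.
  - exact/measurable_EFinP.
  - by move=> w; rewrite lee_fin.
  - move=> n k A nN FA AU; apply: le_trans (gM n.+1 k N.+1 A nN FA).
    have mA := (hF _).2 _ FA.
    rewrite -integral_cst//; apply: ge0_le_integral => //.
    + by move=> w _; rewrite lee_fin ltW.
    + apply: measurable_funTS; apply/measurable_EFinP.
      apply: measurable_norm_strongly.
      apply: (strongly_measurable_subset (hF k).2).
      by have [] := hg n.+1 k isT.
    + by move=> w /AU /ltW; rewrite lee_fin.
set E := [set w | _].
(* A supremum at least eps need not be attained, so the level is lowered to
   c < eps and raised back to eps at the end. *)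
have EW c : c < eps -> E `<=` \bigcup_N W c N.
  move=> ceps w Ew.
  have : (c%:E < ereal_sup [set `|g n1 n2 w|%:E
      | n1 in [set n | (0 < n)%N] & n2 in [set: nat]])%E.
    by apply: lt_le_trans Ew; rewrite lte_fin.
  move=> /ereal_sup_gt[_ [[|n] // _ [k _ <-]]]; rewrite lte_fin => lt_g.
  exists (maxn n k) => //; exists n; first by rewrite /= ltnS leq_maxl.
  by exists k => //; rewrite /= ltnS leq_maxr.
have mE : measurable E.
  have -> : E = \bigcap_m \bigcup_N W (eps * (1 - m.+1%:R^-1)) N.
    apply/seteqP; split => w => [Ew m _|Ew].
      by apply: EW Ew; rewrite gtr_pMr// ltrBlDr ltrDl invr_gt0.
    rewrite /E /=; apply/lee_mul01Pr => [|r /andP[r0 r1]].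
      by rewrite lee_fin ltW.
    have r10 : 0 < 1 - r by rewrite subr_gt0.
    pose m := Num.trunc (1 - r)^-1.
    have [N _ [n _ [k _ /= Uw]]] := Ew m I.
    apply: (@le_trans _ _ `|g n.+1 k w|%:E); last first.
      by apply: ereal_sup_ubound; exists n.+1 => //; exists k.
    rewrite -EFinM lee_fin; apply: le_trans (ltW Uw).
    rewrite mulrC ler_pM2l// lerBrDr -lerBrDl.
    by rewrite -[leRHS]invrK lef_pV2 ?posrE ?invr_gt0// ltW// truncnS_gt.
  by apply: bigcap_measurable => // m _; exact: bigcup_measurable.
have EJ c : 0 < c < eps -> ((c `^ p)%:E * mu E <= J)%E.
  move=> /andP[c0 ceps].
  have Wnd : {homo W c : n m / (n <= m)%N >-> (n <= m)%O}.
    move=> n m nm; apply/subsetPset => w [i /= iN [j /= jN Uw]].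
    by exists i; [exact: leq_trans nm|exists j => //; exact: leq_trans nm].
  have mWc : measurable (\bigcup_N W c N) by exact: bigcup_measurable.
  apply: (@le_trans _ _ ((c `^ p)%:E * mu (\bigcup_N W c N))%E).
    by rewrite lee_wpmul2l ?lee_fin ?powR_ge0// le_measure ?inE//; exact: EW.
  have cvgW := cvgeZl (isT : (c `^ p)%:E \is a fin_num)
    (nondecreasing_cvg_mu (mu := mu) (mW c) mWc Wnd).
  rewrite -(cvg_lim _ cvgW)//; apply: lime_le.
    exact: cvgP cvgW.
  by apply: nearW => N; exact: WJ.
have epsp0 : 0 < eps `^ p by rewrite powR_gt0.
rewrite muleA -JE lee_pdivlMr// muleC; apply/lee_mul01Pr => [|r /andP[r0 r1]].
  by rewrite mule_ge0// lee_fin ltW.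
(* c = eps * r^(1/p) makes c^p = r * eps^p, with r < 1 arbitrary. *)
have rp : (r `^ p^-1) `^ p = r by rewrite -powRrM mulVf ?gt_eqF// powRr1// ltW.
rewrite muleA -EFinM -{1}rp -powRM ?powR_ge0 ?(ltW heps)//; apply: EJ.
rewrite mulr_gt0 ?powR_gt0//= gtr_pMl//.
rewrite (_ : 1 = 1 `^ p^-1); last by rewrite powR1.
by rewrite gt0_ltr_powR ?invr_gt0// ?nnegrE// ltW.
Qed.
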